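(* Let $p\in(0,1)$, let $P=\begin{pmatrix} p_{00} & p_{01} \\ p_{10} & p_{11} \end{pmatrix}$ be a probability (row-stochastic) matrix with positive entries, and let $(p_0,p_1)$ be its left leading normalized eigenvector, i.e. $(p_0,p_1)P=(p_0,p_1)$, $p_0+p_1=1$. Then the measure $\mu$ on $\{0,1\}^{\mathbb{Z}}$ defined on cylinders by $$\mu([a_1,a_2,\dots,a_n]):=p_{a_1}\prod_{i=1}^{n-1}p_{a_i a_{i+1}},\qquad a_i\in\{0,1\},$$ is invariant with respect to the process $\pi(p,v=1,r=1/2,\mathbb{Z})$ if and only if $$p_{00}\,p_{11}=(1-p)\,p_{10}\,p_{01}.$$
   Context: A configuration of particles on $\mathbb{Z}$ with at most one particle per site is identified with a binary sequence in $\{0,1\}^{\mathbb{Z}}$ (1 = occupied site, 0 = empty site). $\pi(p,v=1,r=1/2,\mathbb{Z})$ is the discrete time Markov process on $\{0,1\}^{\mathbb{Z}}$ in which at each time step, simultaneously and independently, every particle at a site $i$ such that site $i+1$ is empty (at the beginning of the step) jumps to $i+1$ with probability $p$ and stays with probability $1-p$; all other particles stay. A probability measure is invariant if it is preserved by the one-step transition kernel. $[a_1,\dots,a_n]$ denotes the cylinder of all sequences having the letters $a_1,\dots,a_n$ at $n$ given consecutive sites; the formula holds for every position of these sites. *)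

(* Defs.v *)
From HB Require Import structures.
From mathcomp Require Import all_boot all_order all_algebra.
From mathcomp Require Import all_classical all_reals all_analysis.

Set Implicit Arguments.
Unset Strict Implicit.
Unset Printing Implicit Defensive.

Import Order.TTheory GRing.Theory Num.Theory.

Local Open Scope classical_set_scope.
Local Open Scope ring_scope.

(* [cylinder i [:: a_1; ...; a_n]] is the cylinder [a_1,...,a_n] placed at the
   sites i, ..., i + n - 1; it is the whole space when n = 0. *)
Definition cylinder (i : int) (s : seq bool) : set (int -> bool) :=
  [set x | forall k : nat, (k < size s)%N -> x (i + k%:Z) = nth false s k].

Definition cylinders : set (set (int -> bool)) :=
  [set C | exists i s, C = cylinder i s].

(* {0,1}^Z with its product sigma-algebra; [true] is an occupied site. *)
Definition config := g_sigma_algebraType cylinders.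

(* One synchronous update of x. The coin w i is attached to the site i and only
   matters when a particle sits there with i + 1 empty; all occupation tests
   refer to x, the configuration at the beginning of the step. *)
Definition jumps (x w : config) (i : int) : bool :=
  [&& x i, ~~ x (i + 1) & w i].

Definition step (x w : config) : config :=
  fun i => (x i && ~~ jumps x w i) || jumps x w (i - 1).

(* [nu] is the product over Z of the Bernoulli(p) laws on the coins: mutual
   independence is the product rule over all finite sets J of sites. *)
Definition iid_bernoulli (R : realType) (p : R) (nu : probability config R) :
    Prop :=
  forall (J : seq int) (B : int -> set bool), uniq J ->
    nu [set w : config | forall j, j \in J -> B j (w j)] =
    (\prod_(j <- J) bernoulli_prob p (B j))%E.

(* [K x] is the law of [step x w] under i.i.d. Bernoulli(p) coins w. This
   determines K, since [iid_bernoulli p] determines nu. *)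
Definition is_one_step_kernel (R : realType) (p : R)
    (K : R.-pker config ~> config) : Prop :=
  exists2 nu : probability config R, iid_bernoulli p nu &
    forall (x : config) (A : set config), measurable A ->
      K x A = nu [set w | A (step x w)].

Definition invariant_measure (R : realType) (K : R.-pker config ~> config)
    (mu : probability config R) : Prop :=
  forall A : set config, measurable A -> (\int[mu]_x K x A = mu A)%E.

Definition letter (b : bool) : 'I_2 := if b then 1 else 0.

(* The product formula is imposed at every position i, for every n >= 1. *)
Definition is_markov_measure (R : realType) (q : 'rV[R]_2) (P : 'M[R]_2)
    (mu : probability config R) : Prop :=
  forall (i : int) (s : seq bool), (0 < size s)%N ->
    mu (cylinder i s) =
    (q 0 (letter (nth false s 0)) *
     \prod_(0 <= k < (size s).-1)
       P (letter (nth false s k)) (letter (nth false s k.+1)))%:E.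

(* Main.v *)
Require Import Defs.
From HB Require Import structures.
From mathcomp Require Import all_boot all_order all_algebra.
From mathcomp Require Import all_classical all_reals all_analysis.
From mathcomp Require Import ring zify.

Import Order.TTheory GRing.Theory Num.Theory.

Local Open Scope classical_set_scope.
Local Open Scope ring_scope.

(** One step of the dynamics turns the configuration x and the i.i.d. coins w
into step x w, so integrating the kernel against mu is evaluating the product
measure mu \x nu on preimages under step (integral_kernel). Two probability
measures that agree on cylinders are equal (eq_measure_cylinders), hence
invariance is a family of identities, one for each word: the weight of the word
after the step must be its Markov weight before the step.

Read the updated word from left to right. Letters of x beyond site j are
independent of the past given x j, and the letter written at j depends on the
past only through the pair (x j, c), where c tells whether a particle arrives
at j from j - 1. Only three such states occur, (0,0), (1,0) and (0,1), because a
particle arrives only at an empty site. So the weight of the updated word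
a_1 ... a_n is F M_(a_1) ... M_(a_n) 1, with one 3 x 3 matrix for each letter
that can be written, the law F of the first state as a row vector, and the
column 1 of ones. The recursion scan computes M_(a_1) ... M_(a_n) 1.

Order the states as above, write t for the transition matrix, and put
  v_0 = (t00^2 / t10, t00 t01 / t10, t01 p)  and  v_1 = (t00, t01, 0).
When t00 t11 = (1-p) t10 t01 one has v_a M_b = t_ab v_b, the entries of v_0 and
of v_1 sum to 1, and F = q_0 v_0 + q_1 v_1. In words: given the updated letters
up to some site, the next state is distributed as v_a, where a is the last of
these letters. The updated word therefore has the weight of the Markov chain
(scan_profile, scan_stationary_chain).

Conversely, the word 11 alone forces the relation: the change of its weight in
one step is p q_1 t10 ((1-p) t10 t01 - t00 t11) (scan_stationary_11), and the
first three factors are nonzero. *)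

(** * The scan of an updated word *)

(** Reduces an equation that holds modulo two others to a polynomial identity;
c1 and c2 are the multipliers of these two. Modulo a single equation, it is
given twice, once with the multiplier 0. *)
Lemma eq_lincomb2 {R : pzRingType} (c1 c2 : R) {l1 r1 l2 r2 x y : R} :
  l1 = r1 -> l2 = r2 -> x - y = c1 * (l1 - r1) + c2 * (l2 - r2) -> x = y.
Proof. by move=> -> ->; rewrite !subrr !mulr0 addr0 => /subr0_eq. Qed.

Section Scan.
Context {R : realType} (p : R) (t : bool -> bool -> R).

Fixpoint chain_weight (a : bool) (s : seq bool) : R :=
  if s is b :: s' then t a b * chain_weight b s' else 1.

Definition jump (x x' w : bool) : bool := [&& x, ~~ x' & w].

(** The letter written at a site holding x, when c tells whether a particle
arrives from the left and c' whether the particle of the site leaves. *)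
Definition updated (x c c' : bool) : bool := (x && ~~ c') || c.

(** The probability that the word s is written from some site on, given the
letter x of that site before the step and the arrival c from its left neighbour.
The sum runs over the next letter and the coin of the site. *)
Fixpoint scan (s : seq bool) (x c : bool) : R :=
  if s is a :: s' then
    \sum_(x' : bool) \sum_(w : bool)
      t x x' * bernoulli_pmf p w *
      (if updated x c (jump x x' w) == a then scan s' x' (jump x x' w) else 0)
  else 1.

Hypothesis t_sum : forall a, t a false + t a true = 1.

Let t_compl a : t a true = 1 - t a false.
Proof. by rewrite -(t_sum a) addrC addKr. Qed.

(** Induction on s: the empty word says that the entries of v_0 and of v_1 sum
to 1, a longer one uses v_a M_b = t_ab v_b. The identity for v_0 is multiplied
by t10, so that no division occurs. *)
Lemma scan_profile (s : seq bool) :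
  t false false * t true true = (1 - p) * t true false * t false true ->
  t false false ^+ 2 * scan s false false
    + t false false * t false true * scan s true false
    + t false true * t true false * p * scan s false true
    = t true false * chain_weight false s
  /\ t false false * scan s false false + t false true * scan s true false
     = chain_weight true s.
Proof.
move=> cond; have t01E := t_compl false; have t11E := t_compl true.
elim: s => [|a s [IH0 IH1]] /=.
  split; last by rewrite !mulr1 t_sum.
  apply: (eq_lincomb2 1 0 cond cond).
  by rewrite t01E t11E; ring.
case: a => /=; rewrite !big_bool /updated /jump /=.
  rewrite -IH1; split.
    by apply: (eq_lincomb2 (t false true * scan s true false) 0 cond cond);
      ring.
  by apply: (eq_lincomb2 (- scan s false false) 0 cond cond); ring.
split.
  by apply: (eq_lincomb2 (t false false) 0 IH0 cond); ring.
by apply: (eq_lincomb2 1 0 IH0 cond); ring.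
Qed.

Context (q : bool -> R).
Hypothesis t10_neq0 : t true false != 0.
Hypothesis q_balance : q false * t false true = q true * t true false.

(** F . scan s, where F is the law of the first state: the state at a site is
determined by its own letter x and by the letter u and the coin w of the site
before it. *)
Definition scan_stationary (s : seq bool) : R :=
  \sum_(u : bool) \sum_(x : bool) \sum_(w : bool)
    q u * t u x * bernoulli_pmf p w * scan s x (jump u x w).

(** This is F = q_0 v_0 + q_1 v_1, multiplied by t10. *)
Lemma scan_stationary_chain (s : seq bool) :
  t false false * t true true = (1 - p) * t true false * t false true ->
  scan_stationary s =
    q false * chain_weight false s + q true * chain_weight true s.
Proof.
move=> cond; have [H0 H1] := scan_profile s cond.
have t01E := t_compl false; have t11E := t_compl true.
apply: (mulfI t10_neq0); rewrite /scan_stationary !big_bool/=.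
rewrite -H1 [RHS]mulrDr [X in _ = X + _]mulrCA -H0 /jump/=.
apply: (eq_lincomb2 (- (q false * scan s false false))
  ((t false false - t true false * (1 - p)) * scan s false false
   + (t true false - t false false) * scan s true false
   - t true false * p * scan s false true) cond q_balance).
by rewrite t01E t11E; ring.
Qed.

(** The pair 11 is destroyed from 110 with probability p, since its right
particle leaves, and created from 1011 with probability p and from 1010 with
probability p (1-p). The balance of these three flows is the right-hand side. *)
Lemma scan_stationary_11 :
  scan_stationary [:: true; true] - q true * t true true =
  p * q true * t true false *
  ((1 - p) * t true false * t false true - t false false * t true true).
Proof.
have t01E := t_compl false; have t11E := t_compl true.
rewrite /scan_stationary /= !big_bool /= /jump /updated /=.
apply: (eq_lincomb2 (t true true * (1 - p * t true false)) 0
  q_balance q_balance).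
by rewrite t01E t11E; ring.
Qed.

End Scan.

(** * Cylinders determine a probability measure *)

Section Cylinders.

Lemma cylinder_nil i : cylinder i [::] = setT.
Proof. by apply/seteqP; split. Qed.

Lemma cylinder_cons i a s (x : config) :
  cylinder i (a :: s) x <-> x i = a /\ cylinder (i + 1) s x.
Proof.
split=> [H|[xi H] [|k]] //=; first split.
- by have := H 0%N isT; rewrite addr0.
- by move=> k ks; rewrite -addrA -intS; exact: (H k.+1).
- by rewrite addr0.
- by move=> ks; rewrite intS addrA; exact: H.
Qed.

Lemma cylinder_rcons i s a (x : config) :
  cylinder i (rcons s a) x <-> cylinder i s x /\ x (i + (size s)%:Z) = a.
Proof.
elim: s i => [|b s IH] i /=.
  by rewrite addr0 cylinder_nil cylinder_cons cylinder_nil /setT/=; tauto.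
by rewrite !cylinder_cons IH intS addrA; tauto.
Qed.

Lemma cylinder1 i a : cylinder i [:: a] = [set x : config | x i = a].
Proof.
by apply/seteqP; split=> x; rewrite cylinder_cons cylinder_nil /setT/=; tauto.
Qed.

Lemma measurable_cylinder i s : measurable (cylinder i s : set config).
Proof. by apply: sub_sigma_algebra; exists i, s. Qed.

Lemma measurable_site (i : int) : measurable_fun setT (fun x : config => x i).
Proof.
apply: (measurable_fun_bool true); rewrite setTI.
rewrite (_ : _ @^-1` _ = cylinder i [:: true]).
  exact: measurable_cylinder.
by rewrite cylinder1.
Qed.

Lemma measurable_config d (T : measurableType d) (f : T -> config) :
  (forall i, measurable_fun setT (fun z => f z i)) -> measurable_fun setT f.
Proof.
move=> mf; apply: (@measurability _ _ T config setT f cylinders erefl).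
move=> _ [_ [i [s ->]] <-].
rewrite setTI; elim: s i => [|a s IH] i.
  by rewrite cylinder_nil preimage_setT.
rewrite (_ : _ @^-1` _ =
  (fun z => f z i) @^-1` [set a] `&` f @^-1` cylinder (i + 1) s).
  apply: measurableI => //.
  by rewrite -[X in measurable X]setTI; exact: mf.
by apply/seteqP; split=> z /cylinder_cons.
Qed.

Definition determined_by (n : nat) (A : set config) : Prop :=
  forall x y : config,
    (forall i : int, (`|i| <= n)%N -> x i = y i) -> A x -> A y.

(** Cylinders on consecutive sites are not stable under intersection: the
windows may leave a gap. The sets that depend on finitely many sites are, and
each of them is a finite disjoint union of cylinders over one window. *)
Definition local (A : set config) : Prop := exists n, determined_by n A.

(** A configuration that reads t on the sites -n, ..., n. *)
Definition extend (n : nat) (t : seq bool) : config :=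
  fun i => nth false t `|(i + n%:Z)%R|%N.

Lemma cylinder_extend n t (x : config) : size t = (n + n).+1 ->
  cylinder (- n%:Z) t x <->
  forall i : int, (`|i| <= n)%N -> x i = extend n t i.
Proof.
move=> st; split=> [xt i i_n|xt k kt].
  have ik : i = - n%:Z + `|(i + n%:Z)%R|%N%:Z by lia.
  by rewrite {1}ik xt// st; lia.
rewrite xt; last lia.
by rewrite /extend addrAC addNr add0r.
Qed.

Lemma determined_by_cover n (A : set config) : determined_by n A ->
  A = \bigcup_(t in [set t : (n + n).+1.-tuple bool | A (extend n t)])
        cylinder (- n%:Z) t.
Proof.
move=> detA; apply/seteqP; split=> [x Ax | x [t /= At]].
  pose t := [tuple x (- n%:Z + (val k)%:Z) | k < (n + n).+1].
  have xt : cylinder (- n%:Z) t x.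
    move=> k; rewrite size_tuple => kn.
    by rewrite -[k]/(val (Ordinal kn)) -tnth_nth tnth_mktuple.
  exists t => //=; apply: detA Ax => i i_n.
  by move/cylinder_extend: xt; apply; rewrite ?size_tuple.
move/cylinder_extend; rewrite size_tuple => /(_ erefl) xt.
by apply: detA At => i /xt.
Qed.

Lemma eq_measure_local {R : realType} (m1 m2 : measure config R) :
  (forall i s, (0 < size s)%N -> m1 (cylinder i s) = m2 (cylinder i s)) ->
  forall A, local A -> m1 A = m2 A.
Proof.
move=> m12 A [n /determined_by_cover ->].
have triv : trivIset [set t : (n + n).+1.-tuple bool | A (extend n t)]
    (fun t => cylinder (- n%:Z) t : set config).
  move=> t u _ _ [x [xt xu]]; apply: val_inj.
  apply: (@eq_from_nth _ false); first by rewrite !size_tuple.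
  by move=> k kt; rewrite -xt// xu// size_tuple -(size_tuple t).
rewrite !measure_fin_bigcup//; try exact: finite_finset;
  try by move=> *; exact: measurable_cylinder.
by apply: eq_fsbigr => t _; apply: m12; rewrite size_tuple.
Qed.

Lemma local_cylinder i s : local (cylinder i s).
Proof.
by exists (`|i| + size s)%N => x y xy xs k ks; rewrite -xs// xy//; lia.
Qed.

Lemma local_setI : setI_closed local.
Proof.
move=> A B [n An] [m Bm]; exists (maxn n m) => x y xy [Ax Bx].
split; [apply: An Ax | apply: Bm Bx] => i i_n; apply: xy; lia.
Qed.

Lemma local_measurable A : local A -> measurable A.
Proof.
move=> [n /determined_by_cover ->]; apply: fin_bigcup_measurable => [|t _].
  exact: finite_finset.
exact: measurable_cylinder.
Qed.

Lemma eq_measure_cylinders {R : realType} (m1 : probability config R)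
    (m2 : measure config R) :
  (forall i s, (0 < size s)%N -> m1 (cylinder i s) = m2 (cylinder i s)) ->
  forall A, measurable A -> m1 A = m2 A.
Proof.
move=> m12; apply: (@measure_unique _ R config local (fun=> setT)) => //.
- apply/seteqP; split.
    apply: smallest_sub => [|_ [i [s ->]]]; first exact: smallest_sigma_algebra.
    by apply: sub_sigma_algebra; exact: local_cylinder.
  apply: smallest_sub => [|A /local_measurable]//.
  exact: sigma_algebra_measurable.
- exact: local_setI.
- by move=> _; exists 0%N.
- by rewrite bigcup_const.
- exact: eq_measure_local.
- by move=> _; rewrite [X in (X < _)%E]probability_setT ltry.
Qed.

End Cylinders.

(** * The joint law of configuration, coins and updated word *)

Section JointEvents.

Definition word_weight {R : realType} (q : bool -> R) (t : bool -> bool -> R)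
    (s : seq bool) : R :=
  if s is a :: s' then q a * chain_weight t a s' else 1.

Lemma word_weight_rcons2 {R : realType} (q : bool -> R) t xs u x :
  word_weight q t (rcons (rcons xs u) x) = word_weight q t (rcons xs u) * t u x.
Proof.
case: xs => [|a xs] /=; first by rewrite !mulr1.
rewrite -mulrA; congr (_ * _); elim: xs a => [|b xs IH] a /=.
  by rewrite !mulr1.
by rewrite IH mulrA.
Qed.

Definition coin_weight {R : realType} (p : R) (s : seq bool) : R :=
  \prod_(b <- s) bernoulli_pmf p b.

Lemma markov_measure_cylinder {R : realType} (q : 'rV[R]_2) (P : 'M[R]_2)
    (mu : probability config R) : is_markov_measure q P mu ->
  forall i s, mu (cylinder i s) =
    (word_weight (fun a => q 0 (letter a))
       (fun a b => P (letter a) (letter b)) s)%:E.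
Proof.
move=> mu_markov i [|a s]; first by rewrite cylinder_nil probability_setT.
rewrite mu_markov//=; congr (_ * _)%:E.
elim: s a => [|b s IH] a /=; first by rewrite big_geq.
by rewrite big_nat_recl//= IH.
Qed.

Lemma iid_bernoulli_cylinder {R : realType} (p : R)
    (nu : probability config R) : 0 <= p <= 1 -> iid_bernoulli p nu ->
  forall i s, nu (cylinder i s) = (coin_weight p s)%:E.
Proof.
move=> p01 iid i s.
pose J := [seq i + k%:Z | k <- iota 0 (size s)].
pose B (j : int) : set bool := [set nth false s `|j - i|%N].
have J_uniq : uniq J.
  by rewrite map_inj_uniq ?iota_uniq// => k k' /addrI[].
rewrite (_ : cylinder i s = [set w : config | forall j, j \in J -> B j (w j)]).
  rewrite iid// big_map /coin_weight -prodEFin.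
  rewrite -[in RHS](mkseq_nth false s) big_map; apply: eq_bigr => k _.
  rewrite bernoulli_probE//= /B addrAC subrr add0r absz_nat.
  case: (nth false s k); rewrite !diracE.
    by rewrite mem_set// memNset//= mule1 mule0 adde0.
  by rewrite memNset// mem_set//= mule1 mule0 add0e.
apply/seteqP; split=> w wB.
  move=> j /mapP[k]; rewrite mem_iota add0n => /andP[_ ks] ->.
  by rewrite /B/= addrAC subrr add0r absz_nat; exact: wB.
move=> k ks; have /wB : i + k%:Z \in J.
  by rewrite /J (map_f (fun k : nat => i + k%:Z))// mem_iota.
by rewrite /B/= addrAC subrr add0r absz_nat.
Qed.

Lemma measure_split_bool {d} {T : measurableType d} {R : realType}
    (m : measure T R) (f : T -> bool) (A : set T) :
  measurable A -> measurable_fun setT f ->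
  m A = (\sum_(b : bool) m (A `&` [set z | f z = b]))%E.
Proof.
move=> mA mf; have mfb b : measurable [set z | f z = b].
  by rewrite -[X in measurable X]setTI; exact: (mf measurableT [set b]).
rewrite big_bool.
have AE : A = (A `&` [set z | f z = true]) `|` (A `&` [set z | f z = false]).
  apply/seteqP; split=> [z Az|z [] []//].
  by case E : (f z); [left | right].
rewrite [in LHS]AE measureU//; try exact: measurableI.
by apply/seteqP; split=> // z [[_ /= ->] [_]].
Qed.

Lemma measurable_step :
  measurable_fun setT (fun z : config * config => step z.1 z.2).
Proof.
apply: measurable_config => i.
have m1 j : measurable_fun setT (fun z : config * config => z.1 j).
  exact: (measurableT_comp (measurable_site j)).
have m2 j : measurable_fun setT (fun z : config * config => z.2 j).
  exact: (measurableT_comp (measurable_site j)).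
have mj j : measurable_fun setT (fun z : config * config => jumps z.1 z.2 j).
  apply: measurable_and => //; apply: measurable_and => //.
  exact: measurable_neg.
apply: measurable_or => //; apply: measurable_and => //.
exact: measurable_neg.
Qed.

(** The start j of the written word is kept apart from the two words that are
read, so that revealing one more letter or coin changes a single argument. *)
Definition joint_event (i : int) (xs ws : seq bool) (j : int) (s : seq bool) :
    set (config * config) :=
  [set z | [/\ cylinder i xs z.1, cylinder i ws z.2 &
               cylinder j s (step z.1 z.2)]].

Lemma measurable_joint_event i xs ws j s : measurable (joint_event i xs ws j s).
Proof.
rewrite (_ : joint_event _ _ _ _ _ = (cylinder i xs `*` cylinder i ws) `&`
  (fun z : config * config => step z.1 z.2) @^-1` cylinder j s).
  apply: measurableI; first by apply: measurableX; exact: measurable_cylinder.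
  rewrite -[X in measurable X]setTI; apply: measurable_step => //.
  exact: measurable_cylinder.
by apply/seteqP; split=> z => [[]|[[]]].
Qed.

Context {R : realType} (m : measure (config * config)%type R).

Lemma joint_event_split_site i xs ws j s :
  m (joint_event i xs ws j s) =
  (\sum_(b : bool) m (joint_event i (rcons xs b) ws j s))%E.
Proof.
rewrite (measure_split_bool _
  (fun z : config * config => z.1 (i + (size xs)%:Z))).
- apply: eq_bigr => b _; congr (m _); apply/seteqP; split=> z.
    by move=> [[? ? ?] /= ?]; split=> //; apply/cylinder_rcons.
  by move=> [/cylinder_rcons[]].
- exact: measurable_joint_event.
- exact: (measurableT_comp (measurable_site _)).
Qed.

Lemma joint_event_split_coin i xs ws j s :
  m (joint_event i xs ws j s) =
  (\sum_(b : bool) m (joint_event i xs (rcons ws b) j s))%E.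
Proof.
rewrite (measure_split_bool _
  (fun z : config * config => z.2 (i + (size ws)%:Z))).
- apply: eq_bigr => b _; congr (m _); apply/seteqP; split=> z.
    by move=> [[? ? ?] /= ?]; split=> //; apply/cylinder_rcons.
  by move=> [? /cylinder_rcons[]].
- exact: measurable_joint_event.
- exact: (measurableT_comp (measurable_site _)).
Qed.

(** The last letter x' of the configuration word sits at j + 1 and the last coin
w' at j, so the letter written at j is already decided. *)
Lemma joint_event_cons i xs u x x' ws w w' a s : size ws = size xs ->
  let j := i + (size xs).+1%:Z in
  joint_event i (rcons (rcons (rcons xs u) x) x')
    (rcons (rcons ws w) w') j (a :: s) =
  if updated x (jump u x w) (jump x x' w') == a then
    joint_event i (rcons (rcons (rcons xs u) x) x')
      (rcons (rcons ws w) w') (j + 1) s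
  else set0.
Proof.
move=> sws j.
have stepj z : cylinder i (rcons (rcons (rcons xs u) x) x') z.1 ->
    cylinder i (rcons (rcons ws w) w') z.2 ->
    step z.1 z.2 j = updated x (jump u x w) (jump x x' w').
  rewrite !cylinder_rcons !size_rcons sws => -[[[_ xu] xx] xx'] [[_ ww] ww'].
  have j1 : j + 1 = i + (size xs).+2%:Z by rewrite /j; lia.
  have j0 : j - 1 = i + (size xs)%:Z by rewrite /j; lia.
  by rewrite /step /jumps subrK j1 j0 xu xx xx' ww ww'.
case: eqP => [E|NE]; apply/seteqP; split=> // z.
- by move=> [? ? /cylinder_cons[]].
- by move=> [H1 H2 ?]; split=> //; apply/cylinder_cons; rewrite stepj.
- by move=> [H1 H2 /cylinder_cons[]]; rewrite stepj.
Qed.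

End JointEvents.

Section Law.
Context {R : realType} (p : R) (q : bool -> R) (t : bool -> bool -> R).
Context (mu nu : probability config R).
Hypothesis muE : forall i s, mu (cylinder i s) = (word_weight q t s)%:E.
Hypothesis nuE : forall i s, nu (cylinder i s) = (coin_weight p s)%:E.

(** The Markov property: once the letters up to site j and the coins up to site
j - 1 are known, the word written from j on has the law given by scan. Each step
of the induction on s reveals one more letter and one more coin. *)
Lemma joint_event_law s i xs u x ws w : size ws = size xs ->
  (mu \x nu)%E (joint_event i (rcons (rcons xs u) x) (rcons ws w)
                  (i + (size xs).+1%:Z) s)
  = (word_weight q t (rcons (rcons xs u) x) * coin_weight p (rcons ws w)
     * scan p t s x (jump u x w))%:E.
Proof.
elim: s xs u x ws w => [|a s IH] xs u x ws w sws.
  rewrite (_ : joint_event _ _ _ _ _ =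
    cylinder i (rcons (rcons xs u) x) `*` cylinder i (rcons ws w)).
    rewrite (product_measure1E mu nu (measurable_cylinder _ _)
      (measurable_cylinder _ _)).
    by rewrite [X in (X * _)%E]muE [X in (_ * X)%E]nuE /= mulr1 EFinM.
  by apply/seteqP; split=> z => [[]|[]]; split=> //; rewrite cylinder_nil.
rewrite joint_event_split_site /= mulr_sumr -sumEFin; apply: eq_bigr => x' _.
rewrite joint_event_split_coin /= mulr_sumr -sumEFin; apply: eq_bigr => w' _.
rewrite joint_event_cons//; case: ifP => _; last by rewrite measure0 !mulr0.
rewrite (_ : _ + 1 = i + (size (rcons xs u)).+1%:Z); last first.
  by rewrite size_rcons; lia.
rewrite IH ?size_rcons ?sws// word_weight_rcons2 /coin_weight.
by rewrite [X in _ * X * _]big_rcons/=; congr (_%:E); ring.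
Qed.

Lemma step_cylinder_law i s :
  (mu \x nu)%E ((fun z => step z.1 z.2) @^-1` cylinder i s) =
  (scan_stationary p t q s)%:E.
Proof.
(* The letter written at i depends on the sites from i - 1 on. *)
have -> : (fun z => step z.1 z.2) @^-1` cylinder i s =
    joint_event (i - 1) [::] [::] i s.
  by apply/seteqP; split=> z => [|[]//]; split=> //; rewrite cylinder_nil.
rewrite joint_event_split_site -sumEFin; apply: eq_bigr => u _.
rewrite joint_event_split_site -sumEFin; apply: eq_bigr => x _.
rewrite joint_event_split_coin -sumEFin; apply: eq_bigr => w _.
have := joint_event_law s (i - 1) [::] u x [::] w erefl.
rewrite subrK /= => ->.
by rewrite /coin_weight big_seq1 mulr1.
Qed.
End Law.

(** * Invariance is a condition on cylinders *)

Section KernelLaw.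
Local Open Scope ereal_scope.
Context {R : realType} {p : R} {mu nu : probability config R}
  {K : R.-pker config ~> config}.
Hypothesis KE : forall (x : config) (A : set config), measurable A ->
  K x A = nu [set w | A (step x w)].

Lemma integral_kernel (A : set config) : measurable A ->
  \int[mu]_x K x A = (mu \x nu) ((fun z => step z.1 z.2) @^-1` A).
Proof.
move=> mA; rewrite /= /product_measure1; apply: eq_integral => x _.
rewrite KE//=; congr (nu _); apply/seteqP; split=> w.
  by move=> Aw; apply/xsectionP.
by move/xsectionP.
Qed.

Lemma invariant_measure_cylinders :
  invariant_measure K mu <->
  forall i s, (mu \x nu) ((fun z => step z.1 z.2) @^-1` cylinder i s) =
    mu (cylinder i s).
Proof.
split=> [inv i s|H A mA].
  by rewrite -integral_kernel ?inv//; exact: measurable_cylinder.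
rewrite integral_kernel//.
pose m2 : measure config R :=
  measure_function_pushforward__canonical__measure_function_Measure
    (mu \x nu) measurable_step.
rewrite -[LHS]/(m2 A); apply/esym; apply: eq_measure_cylinders mA => i s _.
by rewrite /m2/= /pushforward H.
Qed.
End KernelLaw.

(** * The criterion *)

Theorem lemma4 (R : realType) (p : R) (hp : 0 < p < 1)
    (P : 'M[R]_2) (P_gt0 : forall a b, 0 < P a b)
    (P_stochastic : forall a, \sum_b P a b = 1)
    (q : 'rV[R]_2) (q_left_eigenvector : q *m P = q)
    (q_normalized : \sum_a q 0 a = 1)
    (mu : probability config R) (mu_markov : is_markov_measure q P mu)
    (K : R.-pker config ~> config) (K_step : is_one_step_kernel p K) :
  invariant_measure K mu <-> P 0 0 * P 1 1 = (1 - p) * P 1 0 * P 0 1.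
Proof.
have [p_gt0 p_lt1] := andP hp.
have p01 : 0 <= p <= 1 by rewrite !ltW.
pose qb b : R := q 0 (letter b); pose t a b : R := P (letter a) (letter b).
have t_sum a : t a false + t a true = 1.
  rewrite -(P_stochastic (letter a)) big_ord_recl big_ord1.
  by congr (_ + P _ _); apply: val_inj.
have qP b : qb b = qb false * t false b + qb true * t true b.
  rewrite /qb -{1}q_left_eigenvector mxE big_ord_recl big_ord1.
  by congr (_ + q _ _ * P _ _); apply: val_inj.
have t10_neq0 : t true false != 0 by apply: lt0r_neq0; exact: P_gt0.
(* A two-state chain is reversible: stationarity at 0 balances the flows 01
   and 10. *)
have q_balance : qb false * t false true = qb true * t true false.
  by apply: (eq_lincomb2 (qb false) 1 (t_sum false) (qP false)); ring.
have q1_neq0 : qb true != 0.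
  apply/eqP => q1; move/eqP: q_balance; rewrite q1 mul0r mulf_eq0.
  rewrite (gt_eqF (P_gt0 _ _ : 0 < t false true)) orbF => /eqP q0.
  move: q_normalized; rewrite big_ord_recl big_ord1.
  rewrite -/(qb false) q0 (_ : lift _ _ = letter true); last exact: val_inj.
  by rewrite -/(qb true) q1 addr0 => /eqP; rewrite eq_sym oner_eq0.
have [nu iid KE] := K_step.
have muE : forall i s, mu (cylinder i s) = (word_weight qb t s)%:E.
  exact: markov_measure_cylinder q P mu mu_markov.
have nuE := iid_bernoulli_cylinder p nu p01 iid.
rewrite (invariant_measure_cylinders KE).
split=> [/(_ 0 [:: true; true])|cond i s].
  rewrite (step_cylinder_law p qb t mu nu muE nuE) muE => -[].
  rewrite /= mulr1 => /eqP; rewrite -subr_eq0 scan_stationary_11//.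
  rewrite !mulf_eq0 (gt_eqF p_gt0) (negbTE q1_neq0) (negbTE t10_neq0) /=.
  by rewrite subr_eq0 => /eqP ->.
rewrite (step_cylinder_law p qb t mu nu muE nuE) muE scan_stationary_chain//.
case: s => [|a s] /=; congr _%:E; last by rewrite [in RHS]qP; ring.
rewrite !mulr1; move: q_normalized; rewrite big_ord_recl big_ord1.
by rewrite (_ : lift _ _ = letter true) //; exact: val_inj.
Qed.
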